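(* Let $H$ be a graph and let $m = m(n)$ be a positive-integer-valued function with $m(n) = \omega(n^{3/2})$ (that is, $m(n)/n^{3/2}\to\infty$ as $n\to\infty$). Then, as $n\to\infty$, $$\mathcal{M}(H,n,m) \sim \max\{\hom(H,T) : |V(T)|\le n,\ |E(T)|\le m,\ T\in\mathcal{T}\},$$ where $\mathcal{T}$ denotes the set of threshold graphs. Moreover, if $H$ has no induced subgraph isomorphic to $C_4$ or $P_4$, then for all positive integers $n$ and $m$, $$\mathcal{M}(H,n,m) = \max\{\hom(H,T) : |V(T)|\le n,\ |E(T)|\le m,\ T\in\mathcal{T}\}.$$
   Context: Graphs are finite and simple. $\hom(H,G)$ is the number of homomorphisms (edge-preserving vertex maps) from $H$ to $G$. $\mathcal{M}(H,n,m) = \max\{\hom(H,G) : |V(G)|\le n, |E(G)|\le m\}$. $f(n)\sim g(n)$ means $\lim_{n\to\infty} f(n)/g(n)=1$. $C_4$ is the 4-vertex cycle and $P_4$ is the 4-vertex path. $N(u)$ is the neighborhood of $u$ and $\overline{N(u)} = N(u)\cup\{u\}$. A graph is a threshold graph if for any two vertices $u,v$ we have $N(u)\subseteq \overline{N(v)}$ or $N(v)\subseteq\overline{N(u)}$. *)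

(* Defs.v *)
From HB Require Import structures.
From mathcomp Require Import all_boot all_order all_algebra.
From mathcomp Require Import all_classical all_reals all_analysis.

Set Implicit Arguments.
Unset Strict Implicit.
Unset Printing Implicit Defensive.

Section Graphs.

Implicit Types V W : finType.

(* A finite simple graph on V is given by its set of edges, each of which is
   a set of two vertices; sgraph V is itself a finType. *)
Definition sgraph V := {E : {set {set V}} | [forall e in E, #|e| == 2]}.

Definition edges V (G : sgraph V) : {set {set V}} := val G.

Definition adj V (G : sgraph V) (x y : V) : bool := [set x; y] \in edges G.

Definition rel_edges V (r : rel V) : {set {set V}} :=
  [set e : {set V} | [exists x, exists y, [&& x != y, r x y & e == [set x; y]]]].

Fact rel_edges_card2 V (r : rel V) : [forall e in rel_edges r, #|e| == 2].
Proof.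
apply/forall_inP => e; rewrite inE => /existsP[x /existsP[y /and3P[xy _ /eqP->]]].
by rewrite cards2 xy.
Qed.

(* Loops of r are dropped and r is symmetrized: see adj_graph_of_rel. *)
Definition graph_of_rel V (r : rel V) : sgraph V :=
  exist _ (rel_edges r) (rel_edges_card2 r).

Lemma adj_graph_of_rel V (r : rel V) x y :
  adj (graph_of_rel r) x y = (x != y) && (r x y || r y x).
Proof.
rewrite /adj /edges /= inE; apply/existsP/andP => [[a /existsP[b /and3P[ab rab /eqP e]]]|].
  have xy : x != y.
    have /eqP : #|[set x; y]| = 2 by rewrite e cards2 ab.
    by rewrite cards2; case: (x != y).
  split=> //.
  have : x \in [set a; b] by rewrite -e set21.
  have : y \in [set a; b] by rewrite -e set22.
  rewrite !inE => /orP[]/eqP ya /orP[]/eqP xa; subst x y;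
    by rewrite ?eqxx // in xy *; rewrite rab ?orbT.
case=> xy /orP[r1|r1].
  by exists x; apply/existsP; exists y; rewrite xy r1 eqxx.
by exists y; apply/existsP; exists x; rewrite eq_sym xy r1 finset.setUC eqxx.
Qed.

(* The number of homomorphisms from H to G. *)
Definition hom_count V W (H : sgraph V) (G : sgraph W) : nat :=
  #|[set f : {ffun V -> W} |
      [forall x, forall y, adj H x y ==> adj G (f x) (f y)]]|.

Definition isomorphic V W (G : sgraph V) (G' : sgraph W) : Prop :=
  exists2 f : V -> W, bijective f & forall x y, adj G' (f x) (f y) = adj G x y.

Definition induced_graph V (G : sgraph V) (A : {set V}) : sgraph {x : V | x \in A} :=
  graph_of_rel (fun x y => adj G (val x) (val y)).

Definition has_induced V W (H : sgraph V) (F : sgraph W) : Prop :=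
  exists A : {set V}, isomorphic (induced_graph H A) F.

Definition C4 : sgraph 'I_4 :=
  graph_of_rel (fun i j : 'I_4 => val j == i.+1 %% 4).

Definition P4 : sgraph 'I_4 :=
  graph_of_rel (fun i j : 'I_4 => val j == i.+1).

Definition nbr V (G : sgraph V) (u : V) : {set V} := [set v | adj G u v].

Definition closed_nbr V (G : sgraph V) (u : V) : {set V} := u |: nbr G u.

Definition threshold V (G : sgraph V) : bool :=
  [forall u, forall v, (nbr G u \subset closed_nbr G v)
                    || (nbr G v \subset closed_nbr G u)].

(* All the notions above are invariant under isomorphism, so graphs with at
   most n vertices may be taken on the vertex sets 'I_k with k <= n.  A maximum
   is never over the empty set: the edgeless graphs always qualify. *)
Definition max_hom V (H : sgraph V) (n m : nat) : nat :=
  \max_(k < n.+1) \max_(G : sgraph 'I_k | #|edges G| <= m) hom_count H G.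

Definition max_hom_threshold V (H : sgraph V) (n m : nat) : nat :=
  \max_(k < n.+1)
    \max_(T : sgraph 'I_k | (#|edges T| <= m) && threshold T) hom_count H T.

End Graphs.

(* Main.v *)
(**
The Kelmans compression from u to v hands the neighbours of u that are not
neighbours of v over to v.  It keeps the number of edges, and it raises the sum
of the squared degrees unless the neighbourhoods of u and v are nested.

If H has no induced C4 or P4, every component of H[f^-1{u, v}] is a star, and
swapping u and v on suitable components injects the homomorphisms into G into
those into the compressed graph.  A maximiser of hom(H, -) with the largest sum
of squared degrees is therefore threshold.

For general H the injection still handles the maps with at most one vertex over
{u, v}, so a compression loses O(N^(h-2)) of the homomorphisms into a graph on N
vertices, where h = |V(H)|.  Maximising hom(H, -) plus a small multiple of the
sum of squared degrees thus gives, for N large, a graph with nearly nested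
neighbourhoods; sorted by degree, it differs in o(N^2) edges from a staircase
graph, which is threshold.  Applied to the blow-ups of G this shows that
hom(H, G) is at most the supremum over t of hom(H, T) / t^h, where T ranges over
the staircase graphs with nt vertices and mt^2 edges.  Cutting such a T into n
blocks of t consecutive vertices and keeping only the complete pairs of blocks
gives a threshold graph on n vertices.  Only O(n) pairs of blocks are lost, and
each carries a fraction O(n^2 / m^2) of the supremum: replacing the two ends of
an edge of H by any of about mt/n dominating vertices shows this.  The total
relative loss O(n^3 / m^2) tends to 0.
*)
Require Import Defs.
From mathcomp Require Import all_boot perm zify.

Set Implicit Arguments.
Unset Strict Implicit.
Unset Printing Implicit Defensive.

(** * Degrees and the Kelmans compression *)

Lemma leq_card_inj (T T' : finType) (A : {set T}) (B : {set T'}) (f : T -> T') :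
  {in A &, injective f} -> {in A, forall x, f x \in B} -> #|A| <= #|B|.
Proof.
move=> f_inj fAB; rewrite -(card_in_imset f_inj); apply: subset_leq_card.
by apply/subsetP => _ /imsetP[x xA ->]; apply: fAB.
Qed.

Section Graph.
Variables (W : finType) (G : sgraph W).

Lemma adjC x y : adj G x y = adj G y x.
Proof. by rewrite /adj setUC. Qed.

Lemma card_edge e : e \in edges G -> #|e| = 2.
Proof. by move=> eG; apply/eqP/(forall_inP (valP G)). Qed.

Lemma adjxx x : adj G x x = false.
Proof. by apply/negP => /card_edge; rewrite setUid cards1. Qed.

Lemma adj_neq x y : adj G x y -> x != y.
Proof. by apply: contraTneq => ->; rewrite adjxx. Qed.

Definition deg x := #|nbr G x|.

Definition sum_deg := \sum_x deg x.

Definition sum_sq_deg := \sum_x deg x ^ 2.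

Lemma degE x : deg x = \sum_y adj G x y.
Proof.
rewrite /deg -sum1_card big_mkcond; apply: eq_bigr => y _.
by rewrite inE; case: adj.
Qed.

Lemma sum_degE : sum_deg = #|[set p : W * W | adj G p.1 p.2]|.
Proof.
rewrite -sum1_card big_mkcond /sum_deg.
under eq_bigr do rewrite degE.
by rewrite pair_bigA; apply: eq_bigr => -[x y] _; rewrite inE /=; case: adj.
Qed.

Lemma deg_edges x : deg x = #|[set e in edges G | x \in e]|.
Proof.
rewrite /deg -(@card_in_imset _ _ (fun y => [set x; y])); last first.
  move=> y z; rewrite !inE => xy xz /setP/(_ y); rewrite !inE eqxx orbT eq_sym.
  by rewrite eq_sym (negPf (adj_neq (etrans (adjC _ _) xy))) => /esym/eqP.
congr #|pred_of_set _|; apply/setP => e; apply/imsetP/idP => [[y]|].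
  by rewrite !inE => xy ->; rewrite -[in X in X && _]/(adj G x y) xy set21.
rewrite inE => /andP[eG xe]; have /eqP/cards2P[a [b [ab e_ab]]] := card_edge eG.
move: xe eG; rewrite e_ab !inE => /orP[]/eqP-> abG.
  by exists b; rewrite ?inE.
by exists a; rewrite ?inE 1?adjC // setUC.
Qed.

Lemma handshake : sum_deg = 2 * #|edges G|.
Proof.
rewrite /sum_deg; under eq_bigr do rewrite deg_edges.
transitivity (\sum_x \sum_(e in edges G) (x \in e)).
  apply: eq_bigr => x _; rewrite -sum1_card big_mkcond [RHS]big_mkcond.
  by apply: eq_bigr => e _; rewrite inE; case: (e \in _); case: (x \in e).
rewrite exchange_big /= mulnC -sum_nat_const; apply: eq_bigr => e eG.
rewrite -(card_edge eG) -sum1_card [RHS]big_mkcond /=.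
by apply: eq_bigr => x _; case: (x \in e).
Qed.

Lemma leq_edges m : (#|edges G| <= m) = (sum_deg <= 2 * m).
Proof. by rewrite handshake leq_pmul2l. Qed.

Lemma deg_le x : deg x <= #|W|.
Proof. exact: max_card. Qed.

Lemma sum_sq_deg_le : sum_sq_deg <= #|W| ^ 3.
Proof.
apply: (@leq_trans (\sum_(x : W) #|W| ^ 2)).
  by apply: leq_sum => x _; rewrite leq_sqr deg_le.
by rewrite sum_nat_const -expnS.
Qed.

End Graph.

Section Compression.
Variables (W : finType) (G : sgraph W) (u v : W).
Hypothesis uv : u != v.

(* The Kelmans transformation moves the private neighbours of u to v. *)
Definition compress : sgraph W :=
  graph_of_rel (fun x y =>
    if y \in [set u; v] then (x \in [set u; v]) && adj G x y
    else if x == v then adj G u y || adj G v y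
    else if x == u then adj G u y && adj G v y
    else adj G x y).

Local Notation G' := compress.
Local Notation uvs := [set u; v].

Lemma adj_compress_out x y : x \notin uvs -> y \notin uvs ->
  adj G' x y = adj G x y.
Proof.
move=> xn yn; rewrite adj_graph_of_rel (negPf xn) (negPf yn).
move: xn yn; rewrite !inE !negb_or => /andP[/negPf-> /negPf->] /andP[/negPf-> /negPf->].
by rewrite (adjC G y) orbb; case: eqVneq => // ->; rewrite adjxx.
Qed.

Lemma adj_compress_in x y : x \in uvs -> y \in uvs -> adj G' x y = adj G x y.
Proof.
move=> xi yi; rewrite adj_graph_of_rel xi yi (adjC G y) orbb.
by case: eqVneq => // ->; rewrite adjxx.
Qed.

Lemma adj_compress_v y : y \notin uvs -> adj G' v y = adj G u y || adj G v y.
Proof.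
move=> yn; rewrite adj_graph_of_rel set22 (negPf yn) eqxx /= orbF.
by move: yn; rewrite !inE negb_or eq_sym => /andP[_]; rewrite eq_sym => ->.
Qed.

Lemma adj_compress_u y : y \notin uvs -> adj G' u y = adj G u y && adj G v y.
Proof.
move=> yn; rewrite adj_graph_of_rel set21 (negPf yn) eqxx (negPf uv) /= orbF.
by move: yn; rewrite !inE negb_or eq_sym => /andP[->].
Qed.

Lemma big_uv (F : W -> nat) :
  \sum_x F x = F u + F v + \sum_(x | x \notin uvs) F x.
Proof.
rewrite (bigD1 u) //= (bigD1 v) /=; last by rewrite eq_sym.
by rewrite addnA; congr addn; apply: eq_bigl => x; rewrite !inE negb_or.
Qed.

Lemma deg_compress_out x : x \notin uvs -> deg G' x = deg G x.
Proof.
move=> xn; rewrite !degE !big_uv; congr addn; last first.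
  by apply: eq_bigr => y yn; rewrite adj_compress_out.
rewrite !(adjC _ x) adj_compress_u // adj_compress_v //.
by case: (adj G u x); case: (adj G v x).
Qed.

(** Private neighbours of u, of v, and common neighbours. The closed neighbourhoods keep u and v
    themselves out of [a] and [b], so a possible edge uv enters the degree formulas as a separate
    term. *)
Let a := #|nbr G u :\: closed_nbr G v|.
Let b := #|nbr G v :\: closed_nbr G u|.
Let c := \sum_(y | y \notin uvs) (adj G u y && adj G v y).

Lemma deg_u : deg G u = adj G u v + c + a.
Proof.
have -> : a = \sum_(y | y \notin uvs) (adj G u y && ~~ adj G v y).
  rewrite /a -sum1_card big_mkcond big_uv !inE !adjxx !eqxx !andbF !add0n.
  apply: eq_bigr => y; rewrite !inE negb_or => /andP[_ /negPf->].
  by case: (adj G u y); case: (adj G v y).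
rewrite degE big_uv adjxx add0n -addnA -big_split; congr addn.
by apply: eq_bigr => y _; case: (adj G u y); case: (adj G v y).
Qed.

Lemma deg_v : deg G v = adj G u v + c + b.
Proof.
have -> : b = \sum_(y | y \notin uvs) (~~ adj G u y && adj G v y).
  rewrite /b -sum1_card big_mkcond big_uv !inE !adjxx !eqxx !andbF !add0n.
  apply: eq_bigr => y; rewrite !inE negb_or => /andP[/negPf-> _].
  by case: (adj G u y); case: (adj G v y).
rewrite degE big_uv adjxx addn0 adjC -addnA -big_split; congr addn.
by apply: eq_bigr => y _; case: (adj G u y); case: (adj G v y).
Qed.

Lemma deg_compress_u : deg G' u = adj G u v + c.
Proof.
rewrite degE big_uv adjxx add0n adj_compress_in ?set21 ?set22 //; congr addn.
by apply: eq_bigr => y yn; rewrite adj_compress_u.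
Qed.

Lemma deg_compress_v : deg G' v = adj G u v + c + a + b.
Proof.
have E : deg G' v + deg G' u = deg G v + deg G u.
  rewrite !degE !big_uv !adjxx !adj_compress_in ?set21 ?set22 // !(addn0, add0n).
  rewrite addnACA [RHS]addnACA -!big_split; congr addn; apply: eq_bigr => y yn.
  rewrite adj_compress_u // adj_compress_v //.
  by case: (adj G u y); case: (adj G v y).
by move: E; rewrite deg_u deg_v deg_compress_u; lia.
Qed.

Lemma sum_deg_compress : sum_deg G' = sum_deg G.
Proof.
rewrite /sum_deg !big_uv deg_compress_u deg_compress_v deg_u deg_v.
rewrite (eq_bigr _ deg_compress_out); lia.
Qed.

(** With s = [adj G u v + c], the degrees s + a and s + b become s and s + a + b while all others
    stay, and the sum of the two squares grows by exactly 2ab. *)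
Lemma sum_sq_deg_compress : sum_sq_deg G' = sum_sq_deg G + 2 * (a * b).
Proof.
rewrite /sum_sq_deg !big_uv deg_compress_u deg_compress_v deg_u deg_v.
have -> : \sum_(x | x \notin uvs) deg G' x ^ 2 = \sum_(x | x \notin uvs) deg G x ^ 2.
  by apply: eq_bigr => x xn; rewrite deg_compress_out.
rewrite -!mulnn; nia.
Qed.

End Compression.

(** * Homomorphisms under a compression *)

Section Hom.
Variables (V W : finType) (H : sgraph V) (G : sgraph W).

Definition is_hom (f : {ffun V -> W}) :=
  [forall x, forall y, adj H x y ==> adj G (f x) (f y)].

Lemma is_homP (f : {ffun V -> W}) :
  reflect (forall x y, adj H x y -> adj G (f x) (f y)) (is_hom f).
Proof.
apply: (iffP forallP) => [h x y xy|h x]; first exact: (implyP (forallP (h x) y)).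
by apply/forallP => y; apply/implyP; apply: h.
Qed.

Lemma hom_countE : hom_count H G = #|[set f | is_hom f]|.
Proof. by []. Qed.

End Hom.

Section HomCompression.
Variables (V W : finType) (H : sgraph V) (G : sgraph W) (u v : W).
Hypothesis uv : u != v.
Implicit Types f g : {ffun V -> W}.

Local Notation G' := (compress G u v).
Local Notation uvs := [set u; v].

Let pre f : {set V} := [set x | f x \in uvs].

(* For a homomorphism these are the vertices over u and v whose component in
   H[f^-1{u, v}] stops being mapped homomorphically after the compression. *)
Definition moved f x :=
  (x \in pre f) && [exists y, [&& (y == x) || adj H y x, f y == u &
    [exists z, [&& z \notin pre f, adj H y z & ~~ adj G v (f z)]]]].

Definition flip f : {ffun V -> W} :=
  [ffun x => if moved f x then tperm u v (f x) else f x].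

Lemma movedP f x : reflect (x \in pre f /\ exists y z,
    [/\ y = x \/ adj H y x, f y = u, z \notin pre f, adj H y z & ~~ adj G v (f z)])
  (moved f x).
Proof.
apply: (iffP andP) => -[xX].
  move=> /existsP[y /and3P[yx /eqP fy /existsP[z /and3P[zX yz vz]]]].
  by split=> //; exists y, z; split=> //; case/orP: yx => [/eqP|]; [left|right].
move=> [y [z [yx fy zX yz vz]]]; split=> //; apply/existsP; exists y.
rewrite fy eqxx; apply/and3P; split=> //.
  by case: yx => [->|->]; rewrite ?eqxx ?orbT.
by apply/existsP; exists z; rewrite zX yz.
Qed.

Lemma flip_out f x : x \notin pre f -> flip f x = f x.
Proof. by move=> xX; rewrite ffunE /moved (negPf xX). Qed.

Lemma tperm_uvs x : (tperm u v x \in uvs) = (x \in uvs).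
Proof.
rewrite !inE; case: tpermP => [->|->|/eqP/negPf-> /eqP/negPf->] //;
  by rewrite !eqxx ?orbT.
Qed.

Lemma pre_flip f : pre (flip f) = pre f.
Proof. by apply/setP => x; rewrite !inE ffunE -!in_set2; case: ifP; rewrite ?tperm_uvs. Qed.

Lemma in_uvs x : x \in uvs -> x = u \/ x = v.
Proof. by rewrite !inE => /orP[]/eqP; [left|right]. Qed.

(* An edge of H inside X is the middle of no induced P_4 or C_4. *)
Definition no_middle (X : {set V}) := forall x y x' z,
  x \in X -> y \in X -> adj H x y -> adj H x' x -> adj H y z ->
  x' != y -> z != x -> adj H x' y || adj H x z.

(** Suppose y lies over u and has an outside neighbour z with [f z] not adjacent to v. Then the
    component of y is a star centred at y, so one step from y reaches all of it and the flip acts on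
    whole components. *)
Lemma flip_hom f : is_hom H G f -> no_middle (pre f) -> is_hom H G' (flip f).
Proof.
move=> /is_homP fh nm.
(* Otherwise x' x y z is a path with x' and y both over u and x over v; [no_middle] then gives an
   edge inside the fibre of u, or makes v adjacent to [f z]. *)
have moved_edge x x' : x \in pre f -> x' \in pre f -> adj H x x' ->
    moved f x -> moved f x'.
  move=> xX x'X xx' /movedP[_ [y [z [yx fy zX yz vz]]]].
  apply/movedP; split=> //; exists y, z; split=> //.
  case: yx => [->|yx]; first by right.
  have [->|yx'] := eqVneq y x'; first by left.
  have fx : f x = v.
    by move: xX; rewrite inE => /in_uvs[] // fx; have := fh _ _ yx; rewrite fx fy adjxx.
  have fx' : f x' = u.
    by move: x'X; rewrite inE => /in_uvs[] // fx'; have := fh _ _ xx'; rewrite fx fx' adjxx.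
  have yX : y \in pre f by rewrite inE fy set21.
  have zx : z != x by apply: contraNneq zX => ->.
  have := nm x y x' z xX yX; rewrite !(adjC H x) yx (adjC H x') xx' eq_sym yx' zx.
  move=> /(_ isT isT yz isT isT)/orP[x'y|xz].
    by have := fh _ _ x'y; rewrite fx' fy adjxx.
  by have := fh _ _ xz; rewrite fx adjC (negPf vz).
(* The delicate case is x moved from v to u: [f x'] must be a common neighbour of u and v, and the
   path x' x y z forces x' to be adjacent to y. *)
have key x x' : x \in pre f -> x' \notin pre f -> adj H x x' ->
    adj G' (flip f x) (f x').
  move=> xX x'X xx'; have x'X' : f x' \notin uvs by move: x'X; rewrite inE.
  have fxx' := fh _ _ xx'; rewrite ffunE; case: ifP => [|/negP nD].
    move=> /movedP[_ [y [z [yx fy zX yz vz]]]].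
    have [yE|nyx] := eqVneq y x.
      by rewrite -yE fy tpermL adj_compress_v // -fy yE fxx'.
    have {}yx : adj H y x by case: yx nyx => // ->; rewrite eqxx.
    have fx : f x = v.
      by move: xX; rewrite inE => /in_uvs[] // fx; have := fh _ _ yx; rewrite fx fy adjxx.
    rewrite fx tpermR adj_compress_u // -[in X in _ && X]fx fxx' andbT.
    have yX : y \in pre f by rewrite inE fy set21.
    have zx : z != x by apply: contraNneq zX => ->.
    have x'y : x' != y by apply: contraNneq x'X => ->.
    have := nm x y x' z xX yX; rewrite !(adjC H x) yx (adjC H x') xx' x'y zx.
    move=> /(_ isT isT yz isT isT)/orP[/fh|/fh]; first by rewrite adjC fy.
    by rewrite fx adjC (negPf vz).
  move: (xX); rewrite inE => /in_uvs[] fx; rewrite fx; last first.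
    by rewrite adj_compress_v // -[in X in _ || X]fx fxx' orbT.
  rewrite adj_compress_u // -[in X in X && _]fx fxx' /=; apply/negPn/negP => vx'.
  by apply: nD; apply/movedP; split=> //; exists x, x'; split=> //; left.
apply/is_homP => x x' xx'.
have [xX|xX] := boolP (x \in pre f); have [x'X|x'X] := boolP (x' \in pre f).
- have E : moved f x = moved f x'.
    by apply/idP/idP; apply: moved_edge => //; rewrite adjC.
  have [fxX fx'X] : f x \in uvs /\ f x' \in uvs by move: xX x'X; rewrite !inE.
  rewrite !ffunE -E; case: ifP => _; rewrite adj_compress_in ?tperm_uvs //; last exact: fh.
  have := fh _ _ xx'.
  by move: fxX fx'X => /in_uvs[]-> /in_uvs[]->; rewrite ?tpermL ?tpermR ?adjxx // adjC.
- by rewrite (flip_out x'X); apply: key.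
- by rewrite (flip_out xX) adjC; apply: key; rewrite // adjC.
- rewrite !flip_out // adj_compress_out //; first exact: fh.
    by move: xX; rewrite inE.
  by move: x'X; rewrite inE.
Qed.

(** The image determines the moved vertices, and transposing there recovers f. Indeed f and g agree
    outside the common preimage of {u, v}, so the witness z forces y over u for g as well; then g
    moves y, and leaving x unmoved would put the adjacent x and y both over u. *)
Lemma flip_inj : {in [pred f | is_hom H G f] &, injective flip}.
Proof.
have key f g : is_hom H G f -> is_hom H G g -> flip f = flip g ->
    forall x, moved f x -> moved g x.
  move=> /is_homP fh /is_homP gh fg; have preE : pre f = pre g.
    by rewrite -pre_flip fg pre_flip.
  move=> x Dfx; apply: contraT => Dgx; case/movedP: (Dfx).
  move=> xX [y [z [yx fy zX yz vz]]].
  have yX : y \in pre f by rewrite inE fy set21.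
  have Dfy : moved f y by apply/movedP; split=> //; exists y, z; split=> //; left.
  have fzg : f z = g z by rewrite -(flip_out zX) fg flip_out // -preE.
  have gy : g y = u.
    move: (yX); rewrite preE inE => /in_uvs[] // gy; have := gh _ _ yz.
    by rewrite gy -fzg (negPf vz).
  have := congr1 (fun h : {ffun _ -> _} => h y) fg; rewrite !ffunE Dfy fy tpermL.
  case: ifP => [Dgy _|_]; last by rewrite gy => /esym/eqP; rewrite (negPf uv).
  case: yx => [yE|yx]; first by rewrite -yE Dgy in Dgx.
  have fx : f x = v.
    by move: xX; rewrite inE => /in_uvs[] // fx; have := fh _ _ yx; rewrite fx fy adjxx.
  have := congr1 (fun h : {ffun _ -> _} => h x) fg.
  rewrite !ffunE Dfx (negPf Dgx) fx tpermR => gx.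
  by have := gh _ _ yx; rewrite -gx gy adjxx.
move=> f g fh gh fg; apply/ffunP => x.
have := congr1 (fun h : {ffun _ -> _} => h x) fg; rewrite !ffunE.
have -> : moved f x = moved g x by apply/idP/idP; apply: key.
by case: ifP => // _ /perm_inj.
Qed.

(** The predicate [P] serves two uses: it is trivial when H has no induced C4 or P4, and it asks for
    at most one vertex over {u, v} for general H. *)
Lemma card_hom_compress (P : pred {set V}) :
  (forall f, is_hom H G f -> P (pre f) -> no_middle (pre f)) ->
  #|[set f | is_hom H G f & P (pre f)]| <= #|[set f | is_hom H G' f & P (pre f)]|.
Proof.
move=> nm; apply: (leq_card_inj (f := flip)) => [f g|f]; rewrite !inE.
  by move=> /andP[fh _] /andP[gh _]; apply: flip_inj.
by move=> /andP[fh Pf]; rewrite flip_hom ?pre_flip //; apply: nm.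
Qed.

End HomCompression.

(** * Blow-ups, extremal graphs, and the case without induced C4 or P4 *)

Section Spread.
Variables (V W W' : finType) (H : sgraph V) (G : sgraph W) (t : nat).
Variable s : W * 'I_t -> W'.
Hypothesis s_inj : injective s.

(* The t-fold blow-up of G, placed in W' by s. *)
Definition spread : sgraph W' :=
  graph_of_rel (fun x y =>
    [exists p, exists q, [&& s p == x, s q == y & adj G p.1 q.1]]).

Lemma spread_rel p q :
  [exists p', exists q', [&& s p' == s p, s q' == s q & adj G p'.1 q'.1]] =
  adj G p.1 q.1.
Proof.
apply/existsP/idP => [[p' /existsP[q' /and3P[/eqP/s_inj-> /eqP/s_inj->]]]|pq] //.
by exists p; apply/existsP; exists q; rewrite !eqxx.
Qed.

Lemma adj_spread p q : adj spread (s p) (s q) = adj G p.1 q.1.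
Proof.
rewrite adj_graph_of_rel !spread_rel (adjC G q.1) orbb (inj_eq s_inj).
by case: eqVneq => // ->; rewrite adjxx.
Qed.

Lemma sum_deg_spread : sum_deg spread <= t ^ 2 * sum_deg G.
Proof.
rewrite !sum_degE.
pose B := [set p : W * W | adj G p.1 p.2].
have -> : t ^ 2 * #|B| = #|setX [set: 'I_t * 'I_t] B|.
  by rewrite cardsX cardsT card_prod !card_ord.
pose F (p : ('I_t * 'I_t) * (W * W)) := (s (p.2.1, p.1.1), s (p.2.2, p.1.2)).
apply: leq_trans (leq_imset_card F _); apply: subset_leq_card.
have sub x y : [exists p, exists q, [&& s p == x, s q == y & adj G p.1 q.1]] ->
    exists p q, [/\ x = s p, y = s q & adj G p.1 q.1].
  by move=> /existsP[p /existsP[q /and3P[/eqP<- /eqP<- pq]]]; exists p, q.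
apply/subsetP => -[x y]; rewrite inE adj_graph_of_rel /=.
move=> /andP[_ /orP[]/sub[[a i] [[b j] [-> -> /= ab]]]].
  by apply/imsetP; exists ((i, j), (a, b)); rewrite // !inE.
by apply/imsetP; exists ((j, i), (b, a)); rewrite // !inE /= adjC.
Qed.

(** A homomorphism into G lifts by choosing one of the t copies independently at each vertex of
    H. *)
Lemma hom_count_spread : t ^ #|V| * hom_count H G <= hom_count H spread.
Proof.
have -> : t ^ #|V| * hom_count H G =
    #|setX [set: {ffun V -> 'I_t}] [set f | is_hom H G f]|.
  by rewrite cardsX cardsT card_ffun card_ord.
pose F (p : {ffun V -> 'I_t} * {ffun V -> W}) := [ffun x => s (p.2 x, p.1 x)].
apply: (leq_card_inj (f := F)) => [[g f] [g' f'] _ _ E|[g f]].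
  have E' x : (f x, g x) = (f' x, g' x).
    by apply: s_inj; move/ffunP/(_ x): E; rewrite !ffunE.
  by congr (_, _); apply/ffunP => x; case: (E' x).
rewrite !inE => /= /is_homP fh; apply/is_homP => x y xy.
by rewrite !ffunE adj_spread; apply: fh.
Qed.

End Spread.

(** * Attaining the maxima *)

Section Max.
Variables (V : finType) (H : sgraph V).

Lemma hom_count_le_max n m (G : sgraph 'I_n) :
  #|edges G| <= m -> hom_count H G <= max_hom H n m.
Proof.
move=> Gm; rewrite /max_hom.
apply: leq_trans (leq_bigmax_cond (ord_max : 'I_n.+1) isT).
exact: (leq_bigmax_cond (F := fun G : sgraph 'I_n => hom_count H G)).
Qed.

Lemma hom_count_le_max_threshold n m (T : sgraph 'I_n) :
  #|edges T| <= m -> threshold T -> hom_count H T <= max_hom_threshold H n m.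
Proof.
move=> Tm Tt; rewrite /max_hom_threshold.
apply: leq_trans (leq_bigmax_cond (ord_max : 'I_n.+1) isT).
apply: (leq_bigmax_cond (F := fun G : sgraph 'I_n => hom_count H G)).
by rewrite Tm.
Qed.

Lemma max_hom_threshold_le n m : max_hom_threshold H n m <= max_hom H n m.
Proof.
apply/bigmax_leqP => k _; apply/bigmax_leqP => T /andP[Tm _].
apply: leq_trans (leq_bigmax_cond k isT).
exact: (leq_bigmax_cond (F := fun G : sgraph 'I_k => hom_count H G)).
Qed.

Lemma max_hom_attained n m :
  exists2 G : sgraph 'I_n, #|edges G| <= m & max_hom H n m <= hom_count H G.
Proof.
pose G0 : sgraph 'I_n := graph_of_rel (fun _ _ => false).
have G0m : #|edges G0| <= m.
  rewrite leq_edges; suff -> : sum_deg G0 = 0 by [].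
  by rewrite sum_degE; apply: eq_card0 => p; rewrite !inE adj_graph_of_rel andbF.
case: (@arg_maxnP _ G0 (fun G => #|edges G| <= m) (hom_count H) G0m) => G Gm Gmax.
exists G => //; apply/bigmax_leqP => k _; apply/bigmax_leqP => F Fm.
have kn : k <= n by rewrite -ltnS.
(* A blow-up with t = 1 is an embedding; here it pads F with isolated vertices up to exactly n
   vertices. *)
pose s (p : 'I_k * 'I_1) := widen_ord kn p.1.
have s_inj : injective s.
  move=> [i a] [j b] /(congr1 val) /= ij; congr (_, _); first exact: val_inj.
  by rewrite !ord1.
apply: leq_trans (Gmax (spread F s) _).
  by have := @hom_count_spread _ _ _ H F _ s s_inj; rewrite exp1n mul1n.
rewrite leq_edges; apply: leq_trans (sum_deg_spread F s) _.
by rewrite exp1n mul1n -leq_edges.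
Qed.

Lemma thresholdPn (W : finType) (G : sgraph W) : ~~ threshold G ->
  exists u v, [/\ u != v, 0 < #|nbr G u :\: closed_nbr G v|
                & 0 < #|nbr G v :\: closed_nbr G u|].
Proof.
move=> /forallPn[u /forallPn[v]]; rewrite negb_or -!setD_eq0 -!card_gt0.
move=> /andP[a0 b0]; exists u, v; split=> //.
apply: contraTneq a0 => <-; rewrite -leqNgt leqn0 cards_eq0 setD_eq0.
exact: subsetUr.
Qed.

End Max.

(** * Graphs without induced C4 or P4 *)

Section InducedFree.
Variables (V : finType) (H : sgraph V).

Lemma has_induced_inj (W : finType) (F : sgraph W) (g : W -> V) :
  injective g -> (forall i j, adj F i j = adj H (g i) (g j)) -> has_induced H F.
Proof.
move=> g_inj gF; pose A := [set g i | i in [set: W]].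
have gA i : g i \in A by apply: imset_f.
pose h i : {x : V | x \in A} := exist _ (g i) (gA i).
have h_inj : injective h by move=> i j /(congr1 val) /g_inj.
have [|k hk kh] := inj_card_bij h_inj.
  by rewrite card_sig -cardsT -(card_imset _ g_inj); apply: subset_leq_card.
exists A, k; first by exists h.
move=> x y; rewrite gF adj_graph_of_rel -[in RHS](kh x) -[in RHS](kh y) /=.
rewrite (adjC H (g (k y))) orbb (inj_eq h_inj); case: eqVneq => // ->.
by rewrite adjxx.
Qed.

Lemma no_middle_free (X : {set V}) :
  ~ has_induced H C4 -> ~ has_induced H P4 -> no_middle H X.
Proof.
move=> noC4 noP4 x y x' z _ _ xy x'x yz x'y zx; apply: contraT.
rewrite negb_or => /andP[/negPf nx'y /negPf nxz].
have x'z : x' != z by apply: contraTneq x'x => ->; rewrite adjC nxz.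
pose g (i : 'I_4) := nth x' [:: x'; x; y; z] i.
have g_inj : injective g.
  have U : uniq [:: x'; x; y; z].
    rewrite /= !inE !negb_or x'y x'z eq_sym (adj_neq xy) (adj_neq yz).
    by rewrite (eq_sym x z) zx eq_sym (adj_neq x'x).
  by move=> i j /eqP; rewrite nth_uniq ?ltn_ord // => /eqP/val_inj.
have E := (adjC H x x', adjC H y x', adjC H y x, adjC H z x', adjC H z x, adjC H z y,
  adjxx, x'x, xy, yz, nx'y, nxz).
(* The path x' x y z has neither chord x'y nor xz, so the pair x'z alone decides between an induced
   C4 and an induced P4. *)
case x'zE: (adj H x' z); [case: noC4|case: noP4];
  apply: (has_induced_inj g_inj) => -[[|[|[|[|//]]]] ilt] [[|[|[|[|//]]]] jlt];
  by rewrite adj_graph_of_rel /g /= ?E ?x'zE.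
Qed.

Lemma max_hom_free n m : ~ has_induced H C4 -> ~ has_induced H P4 ->
  max_hom H n m = max_hom_threshold H n m.
Proof.
move=> noC4 noP4; apply/eqP; rewrite eqn_leq max_hom_threshold_le andbT.
have [G0 G0m G0max] := max_hom_attained H n m.
(* Sums of squared degrees are at most n^3, so this weight orders graphs lexicographically: first by
   homomorphisms, then by squared degrees. *)
pose F (G : sgraph 'I_n) := hom_count H G * (n ^ 3).+1 + sum_sq_deg G.
case: (@arg_maxnP _ G0 (fun G => #|edges G| <= m) F G0m) => G Gm Gmax.
have sq_le (K : sgraph 'I_n) : sum_sq_deg K <= n ^ 3.
  by have := sum_sq_deg_le K; rewrite card_ord.
have homG : max_hom H n m <= hom_count H G.
  apply: leq_trans G0max _; have := Gmax _ G0m; rewrite /F.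
  have := sq_le G; have := sq_le G0; nia.
apply: (leq_trans homG); apply: hom_count_le_max_threshold => //.
apply/negPn/negP => /thresholdPn[u [v [uv a0 b0]]].
have C_m : #|edges (compress G u v)| <= m.
  by rewrite leq_edges sum_deg_compress // -leq_edges.
have homC : hom_count H G <= hom_count H (compress G u v).
  have E (K : sgraph 'I_n) : hom_count H K =
      #|[set f | is_hom H K f & predT [set x | f x \in [set u; v]]]|.
    by apply: eq_card => f; rewrite !inE andbT.
  by rewrite !E; apply: card_hom_compress => // f _ _; apply: no_middle_free.
have := Gmax _ C_m; rewrite /F (sum_sq_deg_compress G uv).
have : 0 < #|nbr G u :\: closed_nbr G v| * #|nbr G v :\: closed_nbr G u|.
  by rewrite muln_gt0 a0.
nia.
Qed.

End InducedFree.

(** * Graphs with nearly nested neighbourhoods *)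

Lemma card_bigcup_leq (I T : finType) (P : pred I) (F : I -> {set T}) :
  #|\bigcup_(i | P i) F i| <= \sum_(i | P i) #|F i|.
Proof.
elim/big_rec2: _ => [|i B n _ IH]; first by rewrite cards0.
by apply: leq_trans (leq_card_setU _ _) _; rewrite leq_add2l.
Qed.

(** A union bound over ordered pairs; the bound d / c on each event is written as a product to stay
    in the naturals. *)
Lemma card_exists_pair (I T : finType) (C : rel I) (B : I -> I -> pred T) c d :
  (forall x y, C x y -> #|[set f | B x y f]| * c <= d) ->
  #|[set f | [exists x, exists y, C x y && B x y f]]| * c <= #|I| ^ 2 * d.
Proof.
move=> le_d; pose F (p : I * I) := [set f | B p.1 p.2 f].
apply: (@leq_trans (#|\bigcup_(p | C p.1 p.2) F p| * c)).
  rewrite leq_mul2r subset_leq_card ?orbT //; apply/subsetP => f.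
  rewrite inE => /existsP[x /existsP[y /andP[Cxy Bf]]].
  by apply/bigcupP; exists (x, y); rewrite ?inE.
apply: leq_trans (leq_mul (card_bigcup_leq _ _) (leqnn c)) _.
rewrite big_distrl -mulnn -card_prod -sum_nat_const /=.
rewrite big_mkcond /=; apply: leq_sum => -[x y] _ /=.
by case: ifP => // /le_d.
Qed.

Section Update.
Variables (V W : finType) (x y : V).
Hypothesis xy : x != y.

Definition upd2 (f : {ffun V -> W}) p q : {ffun V -> W} :=
  [ffun z => if z == x then p else if z == y then q else f z].

Lemma upd2_x (f : {ffun V -> W}) p q : upd2 f p q x = p.
Proof. by rewrite ffunE eqxx. Qed.

Lemma upd2_y (f : {ffun V -> W}) p q : upd2 f p q y = q.
Proof. by rewrite ffunE eqxx eq_sym (negPf xy). Qed.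

Lemma upd2_eq (f g : {ffun V -> W}) p q p' q' : f x = g x -> f y = g y ->
  upd2 f p q = upd2 g p' q' -> [/\ f = g, p = p' & q = q'].
Proof.
move=> fgx fgy E; split.
- apply/ffunP => z; have := congr1 (fun h : {ffun _ -> _} => h z) E.
  by rewrite !ffunE; case: eqVneq => [->|_] //; case: eqVneq => [->|_].
- by have := congr1 (fun h : {ffun _ -> _} => h x) E; rewrite !upd2_x.
- by have := congr1 (fun h : {ffun _ -> _} => h y) E; rewrite !upd2_y.
Qed.

(** Exchanging (f x, f y) for an arbitrary pair while remembering the old one is injective. The
    factor [#|W| ^ 2] on the left avoids the exponent |V| - 2. *)
Lemma card_pair_maps (S : {set W * W}) :
  #|[set f : {ffun V -> W} | (f x, f y) \in S]| * #|W| ^ 2 <= #|S| * #|W| ^ #|V|.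
Proof.
set A := [set f | _]; have -> : #|A| * #|W| ^ 2 = #|setX A [set: W * W]|.
  by rewrite cardsX cardsT card_prod mulnn.
have -> : #|S| * #|W| ^ #|V| = #|setX S [set: {ffun V -> W}]|.
  by rewrite cardsX cardsT card_ffun.
pose F (p : {ffun V -> W} * (W * W)) := ((p.1 x, p.1 y), upd2 p.1 p.2.1 p.2.2).
apply: (leq_card_inj (f := F)) => [[f [p q]] [g [p' q']] _ _|[f [p q]]].
  by move=> [fgx fgy /(upd2_eq fgx fgy)[-> -> ->]].
by rewrite !inE /= !andbT.
Qed.

End Update.

Section NearlyNested.
Variables (V W : finType) (H : sgraph V).

(** A set with at most one vertex contains no edge, so [no_middle] is vacuous there. Every other map
    sends two distinct vertices of H into {u, v}, for which there are four pairs of values. *)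
Lemma card_hom_compress_loss (G : sgraph W) u v : u != v ->
  hom_count H G * #|W| ^ 2 <=
  hom_count H (compress G u v) * #|W| ^ 2 + #|V| ^ 2 * (4 * #|W| ^ #|V|).
Proof.
move=> uv; pose pre (f : {ffun V -> W}) := [set x | f x \in [set u; v]].
have homP : #|[set f | is_hom H G f & #|pre f| <= 1]| <= hom_count H (compress G u v).
  have := @card_hom_compress _ _ H G _ _ uv (fun X => #|X| <= 1).
  move=> /(_ _)/leq_trans->//; last first.
    by apply: subset_leq_card; apply/subsetP => f; rewrite !inE => /andP[].
  move=> f _ /card_le1_eqP X1 x y x' z xX yX.
  by move/adj_neq; rewrite (X1 _ _ xX yX) eqxx.
pose B x y (f : {ffun V -> W}) := (f x, f y) \in setX [set u; v] [set u; v].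
have lossP : #|[set f : {ffun V -> W} | [exists x, exists y, (x != y) && B x y f]]|
    * #|W| ^ 2 <= #|V| ^ 2 * (4 * #|W| ^ #|V|).
  apply: card_exists_pair => x y xy; apply: leq_trans (card_pair_maps xy _) _.
  by rewrite cardsX cards2 uv.
apply: leq_trans (leq_add (leq_mul homP (leqnn _)) lossP).
rewrite -mulnDl leq_mul2r; apply/orP; right.
apply: leq_trans (leq_card_setU _ _); apply: subset_leq_card.
apply/subsetP => f; rewrite !inE => fh; rewrite /is_hom fh /= leqNgt.
case: ltnP => //= /card_gt1P[x [y [xX yX xy]]].
apply/existsP; exists x; apply/existsP; exists y; rewrite xy /B inE /=.
by move: xX yX; rewrite !inE => -> ->.
Qed.

(* A compression gains 2ab in the sum of squared degrees, with a and b the sizes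
   of the two differences below, against a loss of O(N^(h-2)) homomorphisms. *)
Lemma exists_nearly_nested K (F : sgraph W) : 0 < #|W| ->
  exists G : sgraph W, [/\ sum_deg G <= sum_deg F,
    K * hom_count H F <= K * hom_count H G + #|W| ^ #|V| &
    forall u v, u != v ->
      #|nbr G u :\: closed_nbr G v| * #|nbr G v :\: closed_nbr G u| <=
        2 * K * #|V| ^ 2 * #|W|].
Proof.
move=> W0; set N := #|W|; set h := #|V|.
(* After division by N^3 the second term is at most N^h. At a maximiser, 2ab N^h is at most K N^3
   times the loss 4 h^2 N^(h-2), hence ab <= 2 K h^2 N. *)
pose Phi (G : sgraph W) := K * N ^ 3 * hom_count H G + N ^ h * sum_sq_deg G.
case: (@arg_maxnP _ F (fun G => sum_deg G <= sum_deg F) Phi (leqnn _)) => G GF Gmax.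
exists G; split=> //.
  rewrite -(leq_pmul2l (_ : 0 < N ^ 3)) ?expn_gt0 ?W0 //.
  have := Gmax F (leqnn _); have := sum_sq_deg_le G; rewrite /Phi -/N.
  move=> /(leq_mul (leqnn (N ^ h))); nia.
move=> u v uv; have := Gmax (compress G u v).
rewrite sum_deg_compress // => /(_ GF).
rewrite /Phi sum_sq_deg_compress //.
have := card_hom_compress_loss G uv; rewrite -/N -/h.
set a := #|nbr G u :\: _| * _; set p := hom_count H G; set q := hom_count H _.
move=> /(leq_mul (leqnn (K * N))) loss gain.
rewrite -(leq_pmul2l (_ : 0 < 2 * N ^ h)) ?muln_gt0 ?expn_gt0 ?W0 //.
move: loss gain; rewrite !expnS expn0 !muln1 /geq /=; nia.
Qed.

End NearlyNested.

(** * Staircase graphs *)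

(* R may relate i to itself; stair_graph drops such loops. *)
Definition stair (R : rel nat) :=
  symmetric R /\
  forall i j i' j', i' <= i -> j' <= j -> R i j -> R i' j'.

Definition stair_graph N (R : rel nat) : sgraph 'I_N :=
  graph_of_rel (fun i j : 'I_N => R i j).

Lemma adj_stair N R (i j : 'I_N) : stair R ->
  adj (stair_graph N R) i j = (i != j) && R i j.
Proof. by move=> [Rsym _]; rewrite adj_graph_of_rel (Rsym j) orbb. Qed.

Lemma stair_threshold N R : stair R -> threshold (stair_graph N R).
Proof.
move=> Rs; have [Rsym Rdown] := Rs.
have key (u v : 'I_N) : u <= v ->
    nbr (stair_graph N R) v \subset closed_nbr (stair_graph N R) u.
  move=> uv; apply/subsetP => z; rewrite !inE !adj_stair // => /andP[_ vz].
  by rewrite eq_sym; case: eqVneq => //= _; apply: Rdown vz.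
apply/forallP => u; apply/forallP => v.
by case/orP: (leq_total u v) => /key->; rewrite ?orbT.
Qed.

(** * Sorting a graph by degree *)

Section Dense.
Variables (V W : finType) (H : sgraph V) (G : sgraph W).

Let N := #|W|.
(** [r] is the rank by decreasing degree and [d] the sorted degree sequence; its default 0 beyond N
    keeps it decreasing on all naturals. *)
Let s := sort (fun x y => deg G y <= deg G x) (enum W).
Let r x := index x s.
Let d i := nth 0 (map (deg G) s) i.

Let mem_s x : x \in s.
Proof. by rewrite mem_sort mem_enum. Qed.

Let uniq_s : uniq s.
Proof. by rewrite sort_uniq enum_uniq. Qed.

Let size_s : size s = N.
Proof. by rewrite size_sort -cardE. Qed.

Let r_lt x : r x < N.
Proof. by rewrite -size_s index_mem. Qed.

Let r_inj : injective r.
Proof. by move=> x y /(congr1 (nth x s)); rewrite !nth_index. Qed.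

Let d_r x : d (r x) = deg G x.
Proof. by rewrite /d (nth_map x) ?size_s // nth_index. Qed.

Let d_mono i j : i <= j -> d j <= d i.
Proof.
move=> ij; have [jN|Nj] := ltnP j N; last by rewrite {1}/d nth_default ?size_map ?size_s.
have : sorted geq (map (deg G) s).
  by rewrite sorted_map; apply: sort_sorted => x y; apply: leq_total.
move=> /(sorted_leq_nth (rev_trans leq_trans) leqnn 0) h.
by apply: h; rewrite // inE size_map size_s // (leq_ltn_trans ij).
Qed.

Let card_r k : k <= N -> #|[set z | r z < k]| = k.
Proof.
move=> kN; rewrite -[RHS](size_takel (_ : k <= size s)) ?size_s //.
rewrite -(card_uniqP (take_uniq k uniq_s)); apply: eq_card => z.
by rewrite inE in_take_leq ?size_s ?mem_s.
Qed.

(** If neighbourhoods were nested, rank i would be joined to about the first [d i] ranks. Asking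
    this from both ends gives symmetry and leaves at most [d i] neighbours. *)
Definition degree_stair i j := (j < d i) && (i < d j).

Lemma degree_stairP : stair degree_stair.
Proof.
split=> [i j|i j i' j' ii' jj']; rewrite /degree_stair; first by rewrite andbC.
move=> /andP[ij ji]; apply/andP; split.
  exact: leq_ltn_trans jj' (leq_trans ij (d_mono ii')).
exact: leq_ltn_trans ii' (leq_trans ji (d_mono jj')).
Qed.

Lemma sum_deg_degree_stair : sum_deg (stair_graph N degree_stair) <= sum_deg G.
Proof.
have -> : sum_deg G = \sum_(i < N) d i.
  transitivity (\sum_(x <- s) deg G x).
    by rewrite (perm_big _ (permEl (perm_sort _ (enum W)))) big_enum.
  rewrite -(big_map (deg G) xpredT id) (big_nth 0) size_map size_s big_mkord.
  exact: eq_bigr.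
apply: leq_sum => i _; apply: (@leq_trans #|[set j : 'I_N | j < d i]|).
  apply: subset_leq_card; apply/subsetP => j.
  by rewrite !inE adj_stair; [case/and3P | exact: degree_stairP].
rewrite cardE -(size_map val); apply: (@leq_trans (size (iota 0 (d i)))).
  apply: uniq_leq_size; first by rewrite map_inj_uniq ?enum_uniq //; apply: val_inj.
  by move=> _ /mapP[j + ->]; rewrite mem_enum inE mem_iota add0n.
by rewrite size_iota.
Qed.

(* The two sets have the same size because deg G x vertices are ranked below
   deg G x.  Each pair in excess x * lack x is an inversion. *)
Let excess x := [set y in nbr G x | deg G x <= r y].
Let lack x := [set z | (z \notin nbr G x) && (r z < deg G x)].

Let card_lack x : #|lack x| = #|excess x|.
Proof.
pose P := [set z | r z < deg G x].
have -> : lack x = P :\: nbr G x by apply/setP => z; rewrite !inE.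
have -> : excess x = nbr G x :\: P.
  by apply/setP => z; rewrite !inE -leqNgt andbC.
by rewrite !cardsD setIC card_r // deg_le.
Qed.

(** Since [lack x] and [excess x] have the same size, the left side counts triples with y in
    [excess x] and z in [lack x]. There z ranks before y, so its degree is at least that of y, while
    x is adjacent to y only. Summing over x first gives the right side. *)
Let inversions :
  \sum_x #|excess x| ^ 2 <= \sum_y \sum_(z | deg G y <= deg G z) #|nbr G y :\: nbr G z|.
Proof.
pose I x y z := [&& deg G y <= deg G z, adj G y x & ~~ adj G z x].
apply: (@leq_trans (\sum_x \sum_y \sum_z I x y z)).
  apply: leq_sum => x _; rewrite -mulnn -{2}card_lack -cardsX pair_bigA /=.
  rewrite -sum1_card big_mkcond; apply: leq_sum => -[y z] _ /=.
  case: ifP => //; rewrite !inE /= => /andP[/andP[xy ry] /andP[xz rz]].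
  rewrite /I !(adjC G _ x) xy xz -!d_r d_mono // ltnW //.
  exact: leq_trans rz ry.
rewrite exchange_big; apply: leq_sum => y _; rewrite exchange_big /=.
rewrite [X in _ <= X]big_mkcond; apply: leq_sum => z _; rewrite /I.
case: ifP => //= _; last by rewrite big1.
rewrite -sum1_card [X in _ <= X]big_mkcond; apply: leq_sum => x _.
by rewrite !inE andbC; case: (_ && _).
Qed.

Let bad := [set p : W * W | adj G p.1 p.2 && ~~ degree_stair (r p.1) (r p.2)].

Let card_bad : #|bad| <= 2 * \sum_x #|excess x|.
Proof.
pose A := [set p : W * W | p.2 \in excess p.1].
pose B := [set p : W * W | p.1 \in excess p.2].
have cA : #|A| = \sum_x #|excess x|.
  rewrite -sum1_card big_mkcond.
  under [RHS]eq_bigr => x _ do rewrite -sum1_card big_mkcond.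
  by rewrite pair_bigA; apply: eq_bigr => -[x y] _; rewrite inE.
have cB : #|B| <= #|A|.
  apply: (leq_card_inj (f := fun p : W * W => (p.2, p.1))) => [[x y] [z t] _ _ [-> ->]|[x y]] //.
  by rewrite !inE.
apply: (@leq_trans #|A :|: B|).
  apply: subset_leq_card; apply/subsetP => -[x y]; rewrite !inE /= (adjC G y).
  by move=> /andP[-> ]; rewrite /degree_stair !d_r negb_and -!leqNgt.
by apply: leq_trans (leq_card_setU _ _) _; rewrite -cA; lia.
Qed.

(** Near nestedness leaves at most N^3 / q^2 inversions, hence at most 2 N^2 / q bad pairs, and the
    union bound over edges of H finishes. *)
Lemma hom_count_degree_stair q :
  (forall y z, deg G y <= deg G z -> q ^ 2 * #|nbr G y :\: nbr G z| <= N) ->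
  0 < N ->
  q * hom_count H G <=
    q * hom_count H (stair_graph N degree_stair) + 2 * #|V| ^ 2 * N ^ #|V|.
Proof.
move=> nested N0.
have sq : q ^ 2 * \sum_x #|excess x| ^ 2 <= N ^ 3.
  apply: leq_trans (leq_mul (leqnn _) inversions) _; rewrite big_distrr /=.
  apply: (@leq_trans (\sum_(y : W) N ^ 2)); last by rewrite sum_nat_const -expnS.
  apply: leq_sum => y _; rewrite big_distrr /= big_mkcond /=.
  apply: (@leq_trans (\sum_(z : W) N)); last by rewrite sum_nat_const mulnn.
  by apply: leq_sum => z _; case: ifP => // /nested.
have bad_le : q * #|bad| <= 2 * N ^ 2.
  suff : q * \sum_x #|excess x| <= N ^ 2 by move: card_bad; nia.
  rewrite -(leq_pmul2l (_ : 0 < 2 * N)) ?muln_gt0 //.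
  (* With e the size of [excess x], this uses 2 N (q e) <= N^2 + (q e)^2 for each x. *)
  apply: (@leq_trans (\sum_(x : W) (N ^ 2 + q ^ 2 * #|excess x| ^ 2))).
    rewrite !big_distrr; apply: leq_sum => x _ /=.
    by have := (nat_Cauchy N (q * #|excess x|)).1; rewrite expnMn mulnA.
  have const : \sum_(x : W) N ^ 2 = N ^ 3 by rewrite sum_nat_const -expnS.
  rewrite big_split const -big_distrr /=.
  by rewrite -mulnA -expnS mul2n -addnn leq_add2l.
pose B x y (f : {ffun V -> W}) := (f x, f y) \in bad.
pose lost := [set f : {ffun V -> W} | [exists x, exists y, adj H x y && B x y f]].
have lost_le : #|lost| * N ^ 2 <= #|V| ^ 2 * (#|bad| * N ^ #|V|).
  by apply: card_exists_pair => x y /adj_neq xy; apply: card_pair_maps.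
have kept : #|[set f | is_hom H G f] :\: lost| <= hom_count H (stair_graph N degree_stair).
  pose F (f : {ffun V -> W}) := [ffun x => Ordinal (r_lt (f x))].
  apply: (leq_card_inj (f := F)) => [f g _ _ E|f].
    by apply/ffunP => x; move/ffunP/(_ x): E; rewrite !ffunE => -[/r_inj].
  rewrite !inE => /andP[/existsPn good /is_homP fh]; apply/is_homP => x y xy.
  rewrite adj_stair; last exact: degree_stairP.
  have := good x; move/existsPn/(_ y); rewrite xy /B inE /= fh //= negbK !ffunE /= => ->.
  rewrite andbT -val_eqE /= (inj_eq r_inj); exact: adj_neq (fh _ _ xy).
have total : hom_count H G <= hom_count H (stair_graph N degree_stair) + #|lost|.
  apply: leq_trans (leq_add kept (leqnn _)); rewrite hom_countE.
  apply: leq_trans (leq_card_setU _ _); apply: subset_leq_card.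
  by apply/subsetP => f fh; rewrite !inE in fh *; rewrite fh andbT orNb.
have : q * #|lost| <= 2 * #|V| ^ 2 * N ^ #|V|.
  rewrite -(leq_pmul2r (_ : 0 < N ^ 2)) ?expn_gt0 ?N0 //.
  move: (leq_mul (leqnn q) lost_le) (leq_mul (leqnn (#|V| ^ 2 * N ^ #|V|)) bad_le).
  by nia.
by move: (leq_mul (leqnn q) total); nia.
Qed.

End Dense.

Lemma stair_dense (V : finType) (H : sgraph V) K :
  exists N0, forall N, N0 <= N -> forall F : sgraph 'I_N, exists2 R, stair R &
    sum_deg (stair_graph N R) <= sum_deg F /\
    K * hom_count H F <= K * hom_count H (stair_graph N R) + 2 * N ^ #|V|.
Proof.
(* The factor 2 (h2 + 1) in [q] reduces the sorting loss to at most N^h, and near nestedness costs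
   another N^h. The threshold comes from (a + 1)^2 <= 2 a^2 + 2 <= (2C + 2) N. *)
set h2 := #|V| ^ 2; pose q := 2 * h2.+1 * K; pose C := 2 * K * h2.
exists (q ^ 4 * (2 * C + 2)).+1 => N NN0 F.
have N0 : 0 < #|'I_N| by rewrite card_ord; apply: leq_trans NN0.
have [G [GF homG nested]] := exists_nearly_nested H K F N0.
exists (degree_stair G); first exact: degree_stairP.
have := sum_deg_degree_stair G; have := @hom_count_degree_stair _ _ H G q.
move: NN0 N0 homG nested; rewrite card_ord => NN0 N0 homG nested homS degS.
split; first exact: leq_trans degS GF.
have {}homS := homS _ N0.
have {homS} : q * hom_count H G <=
    q * hom_count H (stair_graph N (degree_stair G)) + 2 * #|V| ^ 2 * N ^ #|V|.
  apply: homS => y z yz; have [->|yNz] := eqVneq y z; first by rewrite setDv cards0 muln0.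
  have := nested _ _ yNz; have := deg_u G yNz; have := deg_v G yNz.
  set c := \sum_(_ | _) _; set a := #|nbr G y :\: closed_nbr G z|; set b := #|_ :\: _| => dz dy ab.
  (* The vertex y of smaller degree has the smaller difference, so the bound on the product bounds
     its square. *)
  have ab' : a <= b by lia.
  have aC : a * a <= C * N by apply: leq_trans ab; rewrite leq_mul2l ab' orbT.
  have : #|nbr G y :\: nbr G z| <= a.+1.
    apply: (@leq_trans #|z |: (nbr G y :\: closed_nbr G z)|).
      apply: subset_leq_card; apply/subsetP => x; rewrite !inE negb_or.
      by case: eqVneq.
    by rewrite cardsU1; case: (_ \notin _).
  move=> le_a; apply: leq_trans (leq_mul (leqnn _) le_a) _.
  rewrite leqNgt; apply/negP => lt_N.
  have : N * N < q ^ 4 * (2 * C + 2) * N; last by rewrite ltn_mul2r [N < _]ltnNge (ltnW NN0) andbF.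
  apply: leq_trans (ltn_mul lt_N lt_N) _.
  rewrite mulnACA -expnD -mulnA leq_mul2l; apply/orP; right; nia.
rewrite /q -/h2 => homS.
rewrite -(leq_pmul2l (_ : 0 < 2 * h2.+1)) //.
move: homG homS; set p := hom_count H F; set p' := hom_count H G.
set p'' := hom_count H _; set Nh := N ^ _; nia.
Qed.

(** * Rounding staircase graphs to blocks *)

Section Dominate.
Variables (N D : nat) (R : rel nat).
Hypotheses (Rs : stair R) (DN : D <= N).

(* D new dominating vertices are put in front of the first N vertices of R. *)
Definition dominate : rel nat :=
  fun i j => [|| i < D, j < D | [&& i - D < N, j - D < N & R (i - D) (j - D)]].

Lemma dominateP : stair dominate.
Proof.
have [Rsym Rdown] := Rs; split=> [i j|i j i' j' ii' jj'].
  by rewrite /dominate Rsym orbCA; congr [|| _, _ | _]; rewrite andbCA.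
move=> /or3P[iD|jD|/and3P[iN jN ij]]; apply/or3P.
- by constructor 1; apply: leq_ltn_trans iD.
- by constructor 2; apply: leq_ltn_trans jD.
constructor 3; apply/and3P; split; [lia|lia|].
by apply: Rdown ij; lia.
Qed.

Lemma sum_deg_dominate :
  sum_deg (stair_graph (2 * N) dominate) <=
    4 * D * N + sum_deg (stair_graph N R).
Proof.
rewrite !sum_degE; set A := [set p | _]; set B := [set p | _].
have D2 : D <= 2 * N by lia.
have ltDN (i : 'I_N) : D + i < 2 * N by have := ltn_ord i; lia.
pose f1 (p : 'I_D * 'I_(2 * N)) := (widen_ord D2 p.1, p.2).
pose f2 (p : 'I_D * 'I_(2 * N)) := (p.2, widen_ord D2 p.1).
pose f3 (p : 'I_N * 'I_N) := (Ordinal (ltDN p.1), Ordinal (ltDN p.2)).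
have sub : A \subset (f1 @: [set: _]) :|: (f2 @: [set: _]) :|: (f3 @: B).
  apply/subsetP => -[i j]; rewrite inE adj_stair; last exact: dominateP.
  move=> /andP[/= ij /or3P[iD|jD|/and3P[iN jN Rij]]]; rewrite !in_setU.
  - apply/orP; left; apply/orP; left; apply/imsetP; exists (Ordinal iD, j) => //.
    by congr (_, _); apply: val_inj.
  - apply/orP; left; apply/orP; right; apply/imsetP; exists (Ordinal jD, i) => //.
    by congr (_, _); apply: val_inj.
  have [iD|Di] := ltnP i D.
    apply/orP; left; apply/orP; left; apply/imsetP; exists (Ordinal iD, j) => //.
    by congr (_, _); apply: val_inj.
  have [jD|Dj] := ltnP j D.
    apply/orP; left; apply/orP; right; apply/imsetP; exists (Ordinal jD, i) => //.
    by congr (_, _); apply: val_inj.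
  apply/orP; right; apply/imsetP; exists (Ordinal iN, Ordinal jN).
    rewrite inE adj_stair //= Rij andbT; apply: contraNneq ij => /(congr1 val) /= E.
    by apply/eqP/val_inj => /=; lia.
  by congr (_, _); apply: val_inj; rewrite /= subnKC.
apply: leq_trans (subset_leq_card sub) _.
apply: leq_trans (leq_card_setU _ _) _; apply: leq_add; last exact: leq_imset_card.
apply: leq_trans (leq_card_setU _ _) _.
apply: leq_trans (leq_add (leq_imset_card _ _) (leq_imset_card _ _)) _.
by rewrite cardsT card_prod !card_ord; lia.
Qed.

End Dominate.

Section PinnedPair.
Variables (V : finType) (H : sgraph V) (N : nat) (R : rel nat) (x y : V).
Hypotheses (Rs : stair R) (xy : x != y).
Implicit Types f : {ffun V -> 'I_N}.

Local Notation T := (stair_graph N R).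

(* Only edges avoiding x and y are preserved, so f x and f y are free, and
   pinning them to z makes the count independent of where the edge xy goes. *)
Definition is_hom_off f := [forall a, forall b,
  [&& a \notin [set x; y], b \notin [set x; y] & adj H a b] ==> adj T (f a) (f b)].

Definition pinned (z : 'I_N) := [set f | [&& is_hom_off f, f x == z & f y == z]].

Lemma card_hom_pair (S : {set 'I_N * 'I_N}) z :
  #|[set f | is_hom H T f & (f x, f y) \in S]| <= #|S| * #|pinned z|.
Proof.
rewrite -cardsX; pose F f := ((f x, f y), upd2 x y f z z).
apply: (leq_card_inj (f := F)) => [f g _ _ [fx fy /(upd2_eq xy fx fy)[]]|f] //.
rewrite !inE => /andP[/is_homP fh ->] /=.
rewrite upd2_x upd2_y // !eqxx !andbT.
apply/forallP => a; apply/forallP => b; apply/implyP; rewrite !inE !negb_or.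
by move=> /and3P[/andP[/negPf ax /negPf ay] /andP[/negPf bx /negPf b_y] /fh];
   rewrite !ffunE ax ay bx b_y.
Qed.

(** Send x to any of the first D dominating vertices, y to any of the next D, and shift the rest by
    2D. Using two disjoint ranges keeps the images of x and y distinct, hence adjacent. *)
Lemma pinned_dominate D z : 2 * D <= N ->
  #|pinned z| * D ^ 2 <= hom_count H (stair_graph (2 * N) (dominate N (2 * D) R)).
Proof.
move=> DN.
have -> : #|pinned z| * D ^ 2 = #|setX (pinned z) [set: 'I_D * 'I_D]|.
  by rewrite cardsX cardsT card_prod !card_ord mulnn.
have lt1 (i : 'I_D) : i < 2 * N by have := ltn_ord i; lia.
have lt2 (i : 'I_D) : D + i < 2 * N by have := ltn_ord i; lia.
have lt3 (i : 'I_N) : 2 * D + i < 2 * N by have := ltn_ord i; lia.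
pose F (p : {ffun V -> 'I_N} * ('I_D * 'I_D)) :=
  upd2 x y [ffun a => Ordinal (lt3 (p.1 a))] (Ordinal (lt1 p.2.1)) (Ordinal (lt2 p.2.2)).
apply: (leq_card_inj (f := F)) => [[f [i j]] [g [i' j']]|[f [i j]]].
  rewrite !inE /= !andbT => /and3P[_ /eqP fx /eqP fy] /and3P[_ /eqP gx /eqP gy].
  move=> /(upd2_eq xy)[||fg [ii'] [/addnI jj']]; rewrite ?ffunE ?fx ?gx ?fy ?gy //.
  congr (_, (_, _)); [apply/ffunP => a | exact: val_inj | exact: val_inj].
  by move/ffunP/(_ a): fg; rewrite !ffunE => -[/addnI/val_inj].
rewrite !inE /= andbT => /and3P[/forallP fh _ _]; apply/is_homP => a b ab.
have Ps : stair (dominate N (2 * D) R) by apply: dominateP.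
have [iD jD] := (ltn_ord i, ltn_ord j).
have dom (p q : 'I_(2 * N)) : val p != val q -> (p < 2 * D) || (q < 2 * D) ->
    adj (stair_graph (2 * N) (dominate N (2 * D) R)) p q.
  by move=> pq pqD; rewrite adj_stair // -val_eqE pq /dominate orbA pqD.
have nab := adj_neq ab; rewrite /F !ffunE /=.
case: (eqVneq a x) => [ea|ax]; [|case: (eqVneq a y) => [ea|ay]];
  (case: (eqVneq b x) => [eb|bx]; [|case: (eqVneq b y) => [eb|b_y]]);
  try (by move: nab; rewrite ea eb eqxx); try (by apply: dom => /=; lia).
have /implyP := forallP (fh a) b; rewrite !inE !negb_or ax ay bx b_y ab => /(_ isT).
rewrite !adj_stair // -!val_eqE /= eqn_add2l => /andP[-> fab].
by rewrite /dominate !addKn !ltn_ord fab !orbT.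
Qed.

End PinnedPair.

Section Coarsen.
Variables (V : finType) (H : sgraph V) (n t : nat) (R : rel nat).
Hypotheses (Rs : stair R) (t0 : 0 < t).

(* Blocks of t consecutive vertices are adjacent when completely joined. *)
Definition coarse : rel nat := fun I J => R (I * t + t.-1) (J * t + t.-1).

Local Notation T := (stair_graph (n * t) R).
Local Notation T' := (stair_graph n coarse).

Lemma coarseP : stair coarse.
Proof.
have [Rsym Rdown] := Rs; split=> [I J|I J I' J' II' JJ']; first exact: Rsym.
by apply: Rdown; rewrite leq_add2r leq_mul2r ?II' ?JJ' orbT.
Qed.

Let cell_lt (I : 'I_n) (i : 'I_t) : I * t + i < n * t.
Proof. by have := ltn_ord I; have := ltn_ord i; nia. Qed.

Let blk_lt (i : 'I_(n * t)) : i %/ t < n.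
Proof. by rewrite ltn_divLR // ltn_ord. Qed.

Let off_lt (i : 'I_(n * t)) : i %% t < t.
Proof. by rewrite ltn_mod. Qed.

Let blk i := Ordinal (blk_lt i).
Let off i := Ordinal (off_lt i).

Let blk_off_inj i j : blk i = blk j -> off i = off j -> i = j.
Proof.
move=> [bij] [oij]; apply: val_inj => /=.
by rewrite (divn_eq i t) (divn_eq j t) bij oij.
Qed.

Lemma sum_deg_coarse : t ^ 2 * sum_deg T' <= sum_deg T.
Proof.
rewrite !sum_degE; set B := [set p | _].
have -> : t ^ 2 * #|B| = #|setX [set: 'I_t * 'I_t] B|.
  by rewrite cardsX cardsT card_prod !card_ord.
pose F (p : ('I_t * 'I_t) * ('I_n * 'I_n)) :=
  (Ordinal (cell_lt p.2.1 p.1.1), Ordinal (cell_lt p.2.2 p.1.2)).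
have inj (I I' : 'I_n) (i i' : 'I_t) :
    I * t + i = I' * t + i' -> I = I' /\ i = i'.
  move=> E; have EI : I = I' :> nat.
    by have := congr1 (divn^~ t) E; rewrite !divnMDl // !divn_small ?addn0.
  by split; apply: val_inj; move: E; rewrite // EI => /addnI.
apply: (leq_card_inj (f := F)) => [[[i j] [I J]] [[i' j'] [I' J']] _ _|[[i j] [I J]]].
  by move=> [/inj[-> ->] /inj[-> ->]].
rewrite !inE /= adj_stair; last exact: coarseP.
move=> /andP[IJ RIJ]; rewrite adj_stair //; apply/andP; split.
  by apply: contraNneq IJ => -[/inj[->]].
have le_t (k : 'I_t) : k <= t.-1 by rewrite -ltnS prednK.
by case: Rs => _; apply; last exact: RIJ; rewrite leq_add2l.
Qed.

(** Cells that may hold an edge of T without being an edge of T': the diagonal ones, and those where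
    the boundary of the staircase passes between the first and the last corner. *)
Let bad_cells := [set C : 'I_n * 'I_n |
  (C.1 == C.2) || (R (C.1 * t) (C.2 * t) && ~~ coarse C.1 C.2)].

(* Each diagonal meets the boundary of the staircase in at most one block. *)
Let card_bad_cells : #|bad_cells| <= 3 * n.
Proof.
pose A := [set C : 'I_n * 'I_n | C.1 == C.2].
pose B := [set C : 'I_n * 'I_n | R (C.1 * t) (C.2 * t) && ~~ coarse C.1 C.2].
have AB : #|bad_cells| <= #|A :|: B|.
  by apply: subset_leq_card; apply/subsetP => C; rewrite !inE.
have cA : #|A| <= #|[set: 'I_n]|.
  by apply: (leq_card_inj (f := fun C : 'I_n * 'I_n => C.1)) => [[I J] [I' J']|C];
    rewrite !inE //= => /eqP<- /eqP<- ->.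
have cB : #|B| <= #|[set: 'I_(2 * n)]|.
  (* This number indexes the diagonal of the cell; adding n keeps I - J nonnegative. *)
  have lt2n (C : 'I_n * 'I_n) : C.1 + (n - C.2) < 2 * n.
    by have := ltn_ord C.1; have := ltn_ord C.2; lia.
  apply: (leq_card_inj (f := fun C => Ordinal (lt2n C))) => [[I J] [I' J']|C]; last by rewrite inE.
  have one_per_diag (i j i' j' : nat) : i < i' -> j < j' -> R (i' * t) (j' * t) -> coarse i j.
    by case: Rs => _ Rdown ii' jj'; apply: Rdown; nia.
  rewrite !inE /= => /andP[R1 n1] /andP[R2 n2] [E].
  have [lJ lJ'] := (ltn_ord J, ltn_ord J').
  case: (ltngtP I I') => II'.
  - by case/negP: n1; apply: one_per_diag R2; lia.
  - by case/negP: n2; apply: one_per_diag R1; lia.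
  by congr (_, _); apply: val_inj => //=; lia.
apply: leq_trans AB _; apply: leq_trans (leq_card_setU _ _) _.
by move: cA cB; rewrite !cardsT !card_ord; lia.
Qed.

Let bad := [set p : 'I_(n * t) * 'I_(n * t) | (blk p.1, blk p.2) \in bad_cells].

Let card_bad : #|bad| <= 3 * n * t ^ 2.
Proof.
apply: (@leq_trans #|setX bad_cells [set: 'I_t * 'I_t]|).
  pose F (p : 'I_(n * t) * 'I_(n * t)) := ((blk p.1, blk p.2), (off p.1, off p.2)).
  apply: (leq_card_inj (f := F)) => [[i j] [i' j'] _ _|[i j]]; last by rewrite !inE andbT.
  by move=> [b1 b2 o1 o2]; congr (_, _); apply: blk_off_inj; apply: val_inj.
by rewrite cardsX cardsT card_prod !card_ord mulnn leq_mul2r card_bad_cells orbT.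
Qed.

(** Either some edge of H falls in a bad cell, which pinning that edge bounds, or the homomorphism
    is one of the t^h lifts of a homomorphism into T'. *)
Lemma hom_count_coarse D : 0 < n -> 2 * D <= n * t ->
  hom_count H T * D ^ 2 <= t ^ #|V| * hom_count H T' * D ^ 2 +
    #|V| ^ 2 * (3 * n * t ^ 2 *
      hom_count H (stair_graph (2 * (n * t)) (dominate (n * t) (2 * D) R))).
Proof.
move=> n0 Dnt; set T2 := stair_graph (2 * _) _.
have z : 'I_(n * t) by apply: (@Ordinal _ 0); rewrite muln_gt0 n0.
pose B x y (f : {ffun V -> 'I_(n * t)}) := is_hom H T f && ((f x, f y) \in bad).
pose lost := [set f : {ffun V -> 'I_(n * t)} | [exists x, exists y, adj H x y && B x y f]].
have lost_le : #|lost| * D ^ 2 <= #|V| ^ 2 * (3 * n * t ^ 2 * hom_count H T2).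
  apply: card_exists_pair => x y /adj_neq xy.
  apply: leq_trans (leq_mul (card_hom_pair H R xy bad z) (leqnn _)) _.
  rewrite -mulnA; apply: leq_mul card_bad _; exact: pinned_dominate.
have kept : #|[set f | is_hom H T f] :\: lost| <= t ^ #|V| * hom_count H T'.
  have -> : t ^ #|V| * hom_count H T' =
      #|setX [set: {ffun V -> 'I_t}] [set f | is_hom H T' f]|.
    by rewrite cardsX cardsT card_ffun card_ord.
  pose F (f : {ffun V -> 'I_(n * t)}) :=
    ([ffun x => off (f x)], [ffun x => blk (f x)]).
  apply: (leq_card_inj (f := F)) => [f g _ _ [/ffunP fg1 /ffunP fg2]|f].
    apply/ffunP => x; apply: blk_off_inj.
      by have := fg2 x; rewrite !ffunE.
    by have := fg1 x; rewrite !ffunE.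
  rewrite !inE /= => /andP[/existsPn good fh]; apply/is_homP => x y xy.
  have := good x; move/existsPn/(_ y); rewrite xy /B fh !inE /= negb_or !ffunE.
  rewrite adj_stair; last exact: coarseP.
  move=> /andP[-> ]; rewrite negb_and negbK => /orP[/negP[]|//].
  have /is_homP/(_ x y xy) := fh; rewrite adj_stair // => /andP[_].
  by case: Rs => _; apply; apply: leq_divM.
have total : hom_count H T <= t ^ #|V| * hom_count H T' + #|lost|.
  apply: leq_trans (leq_add kept (leqnn _)); rewrite hom_countE.
  apply: leq_trans (leq_card_setU _ _); apply: subset_leq_card.
  by apply/subsetP => f fh; rewrite !inE in fh *; rewrite fh andbT orNb.
apply: leq_trans (leq_mul total (leqnn _)) _.
by rewrite mulnDl leq_add2l.
Qed.

End Coarsen.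

(** * Estimates for fixed n and m *)

Section MaxHom.
Variables (V : finType) (H : sgraph V).

Lemma hom_count_le (W : finType) (G : sgraph W) : hom_count H G <= #|W| ^ #|V|.
Proof. by rewrite hom_countE -card_ffun max_card. Qed.

Lemma sum_deg_le (W : finType) (G : sgraph W) : sum_deg G <= #|W| ^ 2.
Proof.
rewrite -mulnn -sum_nat_const; apply: leq_sum => x _; exact: deg_le.
Qed.

(** Capping m at n^2 changes neither maximum, and m <= n^2 is what leaves room for the 2D dominating
    vertices. *)
Let edges_cap n m k (G : sgraph 'I_k) : k <= n ->
  (#|edges G| <= minn m (n ^ 2)) = (#|edges G| <= m).
Proof.
move=> kn; rewrite leq_min [X in _ && X](_ : _ = true) ?andbT //.
rewrite leq_edges; apply: leq_trans (sum_deg_le G) _; rewrite card_ord.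
by apply: (@leq_trans (n ^ 2)); rewrite ?leq_sqr ?leq_pmull.
Qed.

Lemma max_hom_cap n m : max_hom H n (minn m (n ^ 2)) = max_hom H n m.
Proof.
by apply: eq_bigr => k _; apply: eq_bigl => G; apply: edges_cap; rewrite -ltnS.
Qed.

Lemma max_hom_threshold_cap n m :
  max_hom_threshold H n (minn m (n ^ 2)) = max_hom_threshold H n m.
Proof.
apply: eq_bigr => k _; apply: eq_bigl => G; congr (_ && _).
by apply: edges_cap; rewrite -ltnS.
Qed.

Lemma max_hom_gt0 n m : #|V| <= n -> #|V| ^ 2 <= m -> 0 < max_hom H n m.
Proof.
move=> Vn Vm; pose s (p : V * 'I_1) := widen_ord Vn (enum_rank p.1).
have s_inj : injective s.
  move=> [x a] [y b] /(congr1 val) /= /val_inj/enum_rank_inj ->.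
  by rewrite !ord1.
apply: leq_trans (@hom_count_le_max _ H n m (spread H s) _); last first.
  rewrite leq_edges; apply: leq_trans (sum_deg_spread H s) _.
  by rewrite exp1n mul1n; have := sum_deg_le H; lia.
apply: leq_trans (hom_count_spread H H s_inj).
rewrite exp1n mul1n card_gt0; apply/set0Pn; exists [ffun x => x].
by rewrite inE; apply/is_homP => x y; rewrite !ffunE.
Qed.

(** A maximiser is blown up until [stair_dense] applies. After division by t^h the error is 2 n^h /
    K, which is as small as desired for fixed n. *)
Lemma stair_approx n m K : 0 < n -> exists t R, [/\ 0 < t, stair R,
  sum_deg (stair_graph (n * t) R) <= 2 * (m * t ^ 2) &
  K * (t ^ #|V| * max_hom H n m) <=
    K * hom_count H (stair_graph (n * t) R) + 2 * (n * t) ^ #|V|].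
Proof.
move=> n0; have [G Gm Gmax] := max_hom_attained H n m.
have [N0 dense] := stair_dense H K; pose t := N0.+1.
have s_lt (p : 'I_n * 'I_t) : p.1 * t + p.2 < n * t.
  by have := ltn_ord p.1; have := ltn_ord p.2; nia.
pose s p := Ordinal (s_lt p).
have s_inj : injective s.
  move=> [i a] [j b] [] E; have ij : i = j :> nat.
    by have := congr1 (divn^~ t) E; rewrite !divnMDl // !divn_small ?addn0.
  by congr (_, _); apply: val_inj; move: E; rewrite // ij => /addnI.
have [|R Rs [degR homR]] := dense (n * t) _ (spread G s); first by rewrite /t; nia.
exists t, R; split=> //.
  apply: leq_trans degR _; apply: leq_trans (sum_deg_spread G s) _.
  by rewrite leq_edges in Gm; rewrite mulnA mulnC leq_mul2r Gm orbT.
apply: leq_trans homR; rewrite leq_mul2l; apply/orP; right.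
apply: leq_trans (hom_count_spread H G s_inj).
by rewrite leq_mul2l Gmax orbT.
Qed.

Lemma hom_count_coarse_le n m t R : stair R -> 0 < t -> 0 < n ->
  2 * n <= m -> m <= n ^ 2 ->
  sum_deg (stair_graph (n * t) R) <= 2 * (m * t ^ 2) ->
  exists2 R2, stair R2 &
    sum_deg (stair_graph (n * (2 * t)) R2) <= 2 * (m * (2 * t) ^ 2) /\
    hom_count H (stair_graph (n * t) R) * m ^ 2 <=
      t ^ #|V| * max_hom_threshold H n m * m ^ 2 +
      48 * #|V| ^ 2 * n ^ 3 * hom_count H (stair_graph (n * (2 * t)) R2).
Proof.
(* The 2D dominating vertices add at most 8 D n t <= 4 m t^2 to the degree sum, within the budget 8
   m t^2 of the parameter 2t. As D >= 1, rounding costs at most a factor 2. *)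
move=> Rs t0 n0 nm mn degR; pose D := (m * t) %/ (2 * n).
have D1 : D * (2 * n) <= m * t by apply: leq_divM.
have D2 : m * t < D.+1 * (2 * n) by rewrite -ltn_divLR ?muln_gt0.
have D0 : 0 < D by rewrite divn_gt0 ?muln_gt0 //; nia.
have D3 : m * t <= 4 * n * D by nia.
have Dnt : 2 * D <= n * t.
  by rewrite -(leq_pmul2l n0); move: mn; rewrite expnS expn1; nia.
exists (dominate (n * t) (2 * D) R); first exact: dominateP.
rewrite mulnCA; split.
  apply: leq_trans (sum_deg_dominate Rs Dnt) _.
  by move: degR; set d := sum_deg _; rewrite !expnS !expn0 !muln1; nia.
have := hom_count_coarse H Rs t0 n0 Dnt.
have coarse_le : hom_count H (stair_graph n (coarse t R)) <= max_hom_threshold H n m.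
  apply: hom_count_le_max_threshold; last exact/stair_threshold/coarseP.
  rewrite leq_edges -(leq_pmul2l (_ : 0 < t ^ 2)) ?expn_gt0 ?t0 //.
  by apply: leq_trans (sum_deg_coarse n Rs t0) _; move: degR; lia.
set a := hom_count H (stair_graph (n * t) R).
set b := hom_count H (stair_graph (2 * _) _); set c := max_hom_threshold _ _ _.
set q := #|V| ^ 2; set th := t ^ #|V| => main.
have {}main : a * D ^ 2 <= th * c * D ^ 2 + q * (3 * n * t ^ 2 * b).
  by apply: leq_trans main _; rewrite leq_add2r leq_mul2r leq_mul2l coarse_le !orbT.
rewrite -(leq_pmul2r (_ : 0 < D ^ 2)) ?expn_gt0 ?D0 //.
(* Squaring m t <= 4 n D gives 16; with the 3n bad cells this makes 48. *)
have sq : m ^ 2 * t ^ 2 <= 16 * n ^ 2 * D ^ 2.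
  by move: (leq_mul D3 D3); rewrite !expnS !expn0 !muln1; lia.
have := leq_mul (leqnn (m ^ 2)) main; have := leq_mul (leqnn (3 * q * n * b)) sq.
rewrite (expnS n 2); set D' := D ^ 2; set m' := m ^ 2; set t' := t ^ 2; set n' := n ^ 2.
nia.
Qed.

End MaxHom.

(** * Asymptotics *)

From mathcomp Require Import all_boot all_order all_algebra.
From mathcomp Require Import all_classical all_reals all_analysis.
From mathcomp Require Import ring lra.
Import Order.TTheory GRing.Theory Num.Theory.
Import numFieldNormedType.Exports.
Local Open Scope classical_set_scope.
Local Open Scope ring_scope.

Section Asymptotics.
Variables (R : realType) (V : finType) (H : sgraph V).

Let C := (48 * #|V| ^ 2 * 2 ^ #|V|)%N.

(** The supremum of the normalised staircase counts lies above the maximum by blowing up, and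
    coarsening a nearly optimal staircase loses at most a fraction C n^3 / m^2 of it. *)
Lemma max_hom_threshold_ge n m : (0 < n)%N -> (2 * n <= m)%N -> (m <= n ^ 2)%N ->
  (max_hom H n m)%:R * (m%:R ^+ 2 - C%:R * n%:R ^+ 3) <=
    (max_hom_threshold H n m)%:R * m%:R ^+ 2 :> R.
Proof.
move=> n0 nm mn; set h := #|V|; set M := max_hom H n m.
set c := max_hom_threshold H n m.
pose E : set R := [set r | exists t S, [/\ (0 < t)%N, stair S,
  (sum_deg (stair_graph (n * t) S) <= 2 * (m * t ^ 2))%N &
  r = (hom_count H (stair_graph (n * t) S))%:R / t%:R ^+ h]].
have E_ub : ubound E (n%:R ^+ h).
  move=> _ [t [S [t0 _ _ ->]]]; rewrite ler_pdivrMr ?exprn_gt0 ?ltr0n //.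
  rewrite -exprMn -natrM -natrX ler_nat.
  by have := hom_count_le H (stair_graph (n * t) S); rewrite card_ord.
have E_le r : E r -> r <= sup E by move=> Er; apply: ub_le_sup => //; exists (n%:R ^+ h).
have M_le : M%:R <= sup E.
  apply/ler_addgt0Pr => e e0.
  have e_pos : 0 <= 2 * n%:R ^+ h / e :> R.
    by rewrite divr_ge0 ?mulr_ge0 ?exprn_ge0 ?ler0n // ltW.
  (* With K > 2 n^h / e the normalised error of [stair_approx] is below e. *)
  have := archi_boundP e_pos; set K := Num.bound _ => ltK.
  have K0 : 0 < K%:R :> R by apply: le_lt_trans ltK.
  have [t [S [t0 Ss degS homS]]] := stair_approx H m K n0.
  apply: (@le_trans _ _ ((hom_count H (stair_graph (n * t) S))%:R / t%:R ^+ h + e)).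
    have th0 : 0 < t%:R ^+ h :> R by rewrite exprn_gt0 // ltr0n.
    rewrite -(ler_pM2l (mulr_gt0 K0 th0)).
    have := homS; rewrite -(ler_nat R) !(natrM, natrD, natrX, exprMn) -/h -/M => homR.
    have homE := divfK (lt0r_neq0 th0) (hom_count H (stair_graph (n * t) S))%:R.
    rewrite -homE in homR.
    move: ltK; rewrite ltr_pdivrMr // => /ltW/(ler_wpM2r (ltW th0)) ltK.
    by move: homR ltK; lra.
  by rewrite lerD2r; apply: E_le; exists t, S.
have E_sup : has_sup E.
  split; last by exists (n%:R ^+ h).
  have [t [S [t0 Ss degS _]]] := stair_approx H m 0 n0.
  by exists ((hom_count H (stair_graph (n * t) S))%:R / t%:R ^+ h), t, S.
have m2 : 0 < m%:R ^+ 2 :> R.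
  by rewrite exprn_gt0 // ltr0n; apply: leq_trans nm; rewrite muln_gt0.
have sup_le : sup E * (m%:R ^+ 2 - C%:R * n%:R ^+ 3) <= c%:R * m%:R ^+ 2.
  rewrite mulrBr lerBlDr; apply/ler_addgt0Pr => e e0.
  have [r Er ltr] := sup_adherent (divr_gt0 e0 m2) E_sup.
  case: (Er) => t [S [t0 Ss degS rE]].
  have [S2 S2s [deg2 hom2]] := hom_count_coarse_le H Ss t0 n0 nm mn degS.
  have th0 : 0 < t%:R ^+ h :> R by rewrite exprn_gt0 // ltr0n.
  (* The dominated graph belongs to the same family with parameter 2t, so the supremum itself bounds
     the loss; 2^h is the change of normalisation. *)
  have hom2_le : (hom_count H (stair_graph (n * (2 * t)) S2))%:R <=
      sup E * (2 ^+ h * t%:R ^+ h).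
    rewrite -exprMn -natrM -ler_pdivrMr ?exprn_gt0 ?ltr0n ?muln_gt0 //.
    by apply: E_le; exists (2 * t)%N, S2; split; rewrite ?muln_gt0.
  have rm : r * m%:R ^+ 2 <= c%:R * m%:R ^+ 2 + sup E * (C%:R * n%:R ^+ 3).
    rewrite rE mulrAC ler_pdivrMr //.
    move: hom2; rewrite -(ler_nat R) !(natrM, natrD, natrX) -/h -/c => hom2.
    have c0 : 0 <= 48 * #|V|%:R ^+ 2 * n%:R ^+ 3 :> R.
      by rewrite !mulr_ge0 ?exprn_ge0 ?ler0n.
    by move: hom2 (ler_wpM2l c0 hom2_le); lra.
  have : sup E * m%:R ^+ 2 <= (r + e / m%:R ^+ 2) * m%:R ^+ 2.
    by rewrite ler_pM2r //; move: ltr; lra.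
  by rewrite mulrDl divfK ?gt_eqF //; move: rm; lra.
(* If the factor is negative the left side is at most 0 and the claim is trivial. *)
have [D0|D0] := leP 0 (m%:R ^+ 2 - C%:R * n%:R ^+ 3 : R).
  by apply: le_trans sup_le; apply: ler_wpM2r.
apply: (@le_trans _ _ 0); first by rewrite mulr_ge0_le0 ?ler0n // ltW.
by rewrite mulr_ge0 ?ler0n // ltW.
Qed.

Lemma max_hom_asymptotic (m : nat -> nat) :
  ((m n)%:R / (n%:R `^ (3 / 2)) : R) @[n --> \oo] --> +oo ->
  ((max_hom H n (m n))%:R / (max_hom_threshold H n (m n))%:R : R)
    @[n --> \oo] --> (1 : R).
Proof.
move=> m_oo; apply/cvgrPdist_le => e e0.
(* Chosen so that M (1 - d) <= c reads M <= c (1 + e). *)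
pose d := e / (1 + e); have e1 : 0 < 1 + e by lra.
have d0 : 0 < d by rewrite divr_gt0.
have d1 : (1 - d) * (1 + e) = 1 by rewrite /d; field; rewrite gt_eqF.
clearbody d; pose B := 2 + C%:R / d; have B0 : 2 <= B.
  by rewrite lerDl divr_ge0 ?ler0n // ltW.
have BC : C%:R <= d * B ^+ 2.
  have dB : d * B = 2 * d + C%:R by rewrite /B; field; rewrite gt_eqF.
  clearbody B; have : C%:R <= d * B by rewrite dB; lra.
  by rewrite expr2 => /le_trans; apply; rewrite mulrA ler_peMr ?mulr_ge0 //; lra.
clearbody B; near=> n.
have n1 : (0 < n)%N by near: n; exists 1%N.
have n2 : (2 <= n)%N by near: n; exists 2%N.
have nV : (#|V| <= n)%N by near: n; exists #|V|.
have nV2 : (#|V| ^ 2 <= n)%N by near: n; exists (#|V| ^ 2)%N.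
have nB : B ^+ 2 <= n%:R by near: n; apply: nbhs_infty_ger.
have mB : B <= (m n)%:R / (n%:R `^ (3 / 2)) by near: n; move/cvgryPge: m_oo; apply.
have n0 : 0 < n%:R :> R by rewrite ltr0n.
have p0 : 0 < n%:R `^ (3 / 2) :> R by apply: powR_gt0.
have p2 : (n%:R `^ (3 / 2)) ^+ 2 = n%:R ^+ 3 :> R.
  by rewrite -powR_mulrn ?powR_ge0 // -powRrM -powR_mulrn ?ler0n //; congr powR; lra.
move: mB; rewrite ler_pdivlMr // => mB.
have mB2 : B ^+ 2 * n%:R ^+ 3 <= (m n)%:R ^+ 2.
  by rewrite -p2 -exprMn ler_sqr ?nnegrE // mulr_ge0 ?powR_ge0 //; lra.
rewrite -(max_hom_cap H n (m n)) -(max_hom_threshold_cap H n (m n)).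
set k := minn (m n) (n ^ 2).
(* When the cap n^2 is the minimum, this is n^4 >= B^2 n^3, which is why n >= B^2 was imposed. *)
have kB : B ^+ 2 * n%:R ^+ 3 <= k%:R ^+ 2.
  rewrite /k /minn; case: ifP => _ //.
  by rewrite natrX -exprM (exprS _ 3) ler_pM2r ?exprn_gt0.
have nk : (2 * n <= k)%N.
  rewrite leq_min; apply/andP; split; last by rewrite expnS expn1 leq_mul2r n2 orbT.
  rewrite -(ler_nat R) -ler_sqr ?nnegrE ?ler0n //; apply: le_trans mB2.
  rewrite natrM exprMn ler_pM ?exprn_ge0 ?ler0n //.
    by rewrite ler_sqr ?nnegrE //; lra.
  by rewrite (exprS _ 2) ler_peMl ?exprn_ge0 ?ler1n.
have kn : (k <= n ^ 2)%N by apply: geq_minr.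
have := max_hom_threshold_ge n1 nk kn.
have M0 : (0 < max_hom H n k)%N.
  by apply: max_hom_gt0 => //; apply: leq_trans nV2 (leq_trans _ nk); rewrite leq_pmull.
have := max_hom_threshold_le H n k.
set M := max_hom H n k in M0 *; set c := max_hom_threshold H n k => cM main.
have k2 : 0 < k%:R ^+ 2 :> R.
  by rewrite exprn_gt0 // ltr0n; apply: leq_trans nk; rewrite muln_gt0.
have dk : C%:R * n%:R ^+ 3 <= d * k%:R ^+ 2 :> R.
  apply: le_trans (ler_wpM2r _ BC) _; first by rewrite exprn_ge0.
  by rewrite -mulrA ler_pM2l.
have Mc : M%:R * (1 - d) <= c%:R :> R.
  rewrite -(ler_pM2r k2); apply: le_trans main; rewrite -mulrA ler_wpM2l //.
  by rewrite mulrBl mul1r lerB.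
have McE : M%:R <= c%:R * (1 + e) :> R.
  by rewrite -(ler_pM2r (_ : 0 < 1 + e)) // -mulrA d1 mulr1 in Mc.
have M0' : 0 < M%:R :> R by rewrite ltr0n.
have c0 : 0 < c%:R :> R by rewrite -(pmulr_lgt0 _ e1); apply: lt_le_trans McE.
have cM' : c%:R <= M%:R :> R by rewrite ler_nat.
have ratio_ge : 1 <= M%:R / c%:R :> R by rewrite ler_pdivlMr ?mul1r.
have ratio_le : M%:R / c%:R <= 1 + e :> R by rewrite ler_pdivrMr // mulrC.
rewrite ler_norml; move: (_ / _) ratio_ge ratio_le => q q1 qe.
by apply/andP; split; lra.
Unshelve. all: by end_near. Qed.

End Asymptotics.

Theorem theorem1p4 (R : realType) (V : finType) (H : sgraph V) :
  (forall m : nat -> nat,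
     (forall n : nat, (0 < n)%N -> (0 < m n)%N) ->
     ((m n)%:R / (n%:R `^ (3 / 2)) : R) @[n --> \oo] --> +oo ->
     ((max_hom H n (m n))%:R / (max_hom_threshold H n (m n))%:R : R)
       @[n --> \oo] --> (1 : R)) /\
  (~ has_induced H C4 -> ~ has_induced H P4 ->
   forall n m : nat, (0 < n)%N -> (0 < m)%N ->
     max_hom H n m = max_hom_threshold H n m).
Proof.
split=> [m _|noC4 noP4 n m _ _]; first exact: max_hom_asymptotic.
exact: max_hom_free.
Qed.
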